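(* For all $(a,b)\in\mathbb{C}^2\setminus\{(0,0)\}$ and $(X,T)\in\mathbb{R}^2$, $$\Psi(X,-T;\mathbf{G}(a,b))=\Psi(X,T;\mathbf{G}(a,b)^* )^*.$$
   Context: Notation: $*$ is complex conjugation (entrywise on matrices, no transpose, so $\mathbf{G}(a,b)^*=\mathbf{G}(a^*,b^* )$); $\sigma_3=\mathrm{diag}(1,-1)$; $\mathrm{e}^{f\sigma_3}=\mathrm{diag}(\mathrm{e}^{f},\mathrm{e}^{-f})$. For $(a,b)\in\mathbb{C}^2\setminus\{(0,0)\}$ let $$\mathbf{G}(a,b)=\frac{1}{\sqrt{|a|^2+|b|^2}}\begin{bmatrix}a & b^*\\ -b & a^*\end{bmatrix}.$$ For $(X,T)\in\mathbb{R}^2$ and $\mathbf{G}=\mathbf{G}(a,b)$, $\mathbf{P}(\Lambda;X,T,\mathbf{G})$ denotes the unique (it is known to exist) $2\times 2$ matrix function of $\Lambda$ such that: (i) it is analytic for $|\Lambda|\neq 1$ and takes continuous boundary values on the unit circle from the interior and from the exterior; (ii) writing $\mathbf{P}_+$ (resp. $\mathbf{P}_-$) for the boundary value on $|\Lambda|=1$ from the exterior (resp. interior), $$\mathbf{P}_+=\mathbf{P}_-\,\mathrm{e}^{-\mathrm{i}(\Lambda X+\Lambda^2T+2\Lambda^{-1})\sigma_3}\,\mathbf{G}\,\mathrm{e}^{\mathrm{i}(\Lambda X+\Lambda^2T+2\Lambda^{-1})\sigma_3},\quad |\Lambda|=1;$$ (iii) $\mathbf{P}\to\mathbb{I}$ as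 $\Lambda\to\infty$. Then $\Psi(X,T;\mathbf{G}):=2\mathrm{i}\lim_{\Lambda\to\infty}\Lambda P_{12}(\Lambda;X,T,\mathbf{G})$. *)

(* Defs.v *)
From Stdlib Require Import Reals ClassicalEpsilon.
From Coquelicot Require Import Coquelicot.

Open Scope C_scope.

(** ** Complex exponential and 2 x 2 complex matrices *)

Definition Cexp (z : C) : C :=
  RtoC (exp (Re z)) * (cos (Im z), sin (Im z)).

Definition M2 : Type := @matrix C 2 2.

(* Zero-based indices: the entry A_{12} in one-based notation is [entry A 0 1]. *)
Definition entry (A : M2) (i j : nat) : C := coeff_mat (RtoC 0) A i j.

Definition mat2 (x00 x01 x10 x11 : C) : M2 :=
  mk_matrix 2 2 (fun i j =>
    match i, j with
    | O, O => x00
    | O, _ => x01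
    | _, O => x10
    | _, _ => x11
    end).

Definition Mmul2 (A B : M2) : M2 := @Mmult C_Ring 2 2 2 A B.

Definition Mid2 : M2 := @Mone C_Ring 2.

(* Entrywise conjugation, without transposition. *)
Definition Mconj2 (A : M2) : M2 :=
  mk_matrix 2 2 (fun i j => Cconj (entry A i j)).

Definition exp_sigma3 (f : C) : M2 := mat2 (Cexp f) 0 0 (Cexp (- f)).

Definition Gmat (a b : C) : M2 :=
  let n := RtoC (sqrt (Cmod a ^ 2 + Cmod b ^ 2)) in
  mat2 (a / n) (Cconj b / n) (- b / n) (Cconj a / n).

(** ** Limits and analyticity *)

Definition C_infty (Q : C -> Prop) : Prop :=
  exists r : R, forall z : C, (r < Cmod z)%R -> Q z.

Definition interior (z : C) : Prop := (Cmod z < 1)%R.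
Definition exterior (z : C) : Prop := (1 < Cmod z)%R.
Definition circle (z : C) : Prop := Cmod z = 1%R.

Definition M2_lim (F : C -> M2) (flt : (C -> Prop) -> Prop) (A : M2) : Prop :=
  forall i j : nat, (i < 2)%nat -> (j < 2)%nat ->
    filterlim (fun z => entry (F z) i j) flt (locally (entry A i j)).

(* Used only on open sets, where complex differentiability at every point is
   analyticity. *)
Definition M2_cderivable (F : C -> M2) (z : C) : Prop :=
  forall i j : nat, (i < 2)%nat -> (j < 2)%nat ->
    @ex_derive C_AbsRing C_NormedModule (fun w => entry (F w) i j) z.

(** ** The Riemann-Hilbert problem *)

Definition phase (X T : R) (L : C) : C :=
  L * RtoC X + L ^ 2 * RtoC T + 2 / L.

Definition jump (X T : R) (G : M2) (L : C) : M2 :=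
  Mmul2 (Mmul2 (exp_sigma3 (- (Ci * phase X T L))) G)
        (exp_sigma3 (Ci * phase X T L)).

(* A candidate [P] is a total function on [C]; its values on the unit circle
   itself are irrelevant, so "the unique solution" means unique off the circle.
   The boundary values [Pp] (from the exterior) and [Pm] (from the interior)
   are full, not merely nontangential, limits. *)
Record solves_RHP (X T : R) (G : M2) (P : C -> M2) : Prop := {
  RHP_analytic :
    forall L : C, Cmod L <> 1%R -> M2_cderivable P L;
  RHP_boundary :
    exists Pp Pm : C -> M2,
      (forall L, circle L ->
         M2_lim P (within exterior (locally L)) (Pp L) /\
         M2_lim P (within interior (locally L)) (Pm L) /\
         M2_lim Pp (within circle (locally L)) (Pp L) /\
         M2_lim Pm (within circle (locally L)) (Pm L)) /\
      (forall L, circle L -> Pp L = Mmul2 (Pm L) (jump X T G L));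
  RHP_infinity : M2_lim P C_infty Mid2
}.

(* Some element satisfying [Q] if there is one, and [d] otherwise. *)
Definition choose_or {A : Type} (d : A) (Q : A -> Prop) : A :=
  match excluded_middle_informative (exists x, Q x) with
  | left h => proj1_sig (constructive_indefinite_description Q h)
  | right _ => d
  end.

(* Existence and uniqueness (off the circle) of the solution are theorems when
   [G = Gmat a b] with [(a, b) <> (0, 0)]; the default value is never used. *)
Definition RHP_solution (X T : R) (G : M2) : C -> M2 :=
  choose_or (fun _ => Mid2) (solves_RHP X T G).

Definition lim_infty (f : C -> C) : C :=
  choose_or (RtoC 0) (fun l => filterlim f C_infty (locally l)).

Definition Psi (X T : R) (G : M2) : C :=
  2 * Ci * lim_infty (fun L => L * entry (RHP_solution X T G L) 0 1).

(* Main.v *)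
(* If [P] solves the problem for [(X, T, conj G)], then [L |-> conj (P (- conj L))]
   solves it for [(X, -T, G)]: the map [L |-> - conj L] preserves the inside and the outside of
   the circle, and conjugating the phase at [- conj L] gives minus the phase with [T]
   negated. So solutions for the two data correspond, and it remains to see that
   [P_12] outside the circle does not depend on the choice of the solution.

   For two solutions [P, Q], the numbers [P_i0 Q_k1 - P_i1 Q_k0] are analytic off
   the circle and do not jump across it, since the jump has determinant 1; if such
   functions are constant, the relations obtained determine [P_12].

   A function [f] continuous on the plane, analytic off the circle, with limit [c]
   at infinity is constant outside: for [|w| > 1] and
   [g(z) = (f z - f w) / (z - w)], the integral of [g(z) dz / i] over the circle of
   radius [r] depends continuously on [r], is locally constant except at [r = 1]
   and [r = |w|] (Goursat, in polar coordinates), vanishes at [r = 0], and tends to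
   [2 PI (c - f w)] as [r] grows. *)
Require Import Defs.
From Stdlib Require Import Reals Lra Lia ClassicalEpsilon.
From Coquelicot Require Import Coquelicot.

Local Open Scope R_scope.

(** * Goursat's lemma for real vector fields *)

(** If [P] failed, it would fail on one quarter, then on a quarter of that one, and so on. These
    nested rectangles shrink to a point, where the local hypothesis gives a contradiction. *)
Lemma rectangle_bisection (P : R -> R -> R -> R -> Prop) (a b c d : R) :
  a <= b -> c <= d ->
  (forall a b c d, a <= b -> c <= d ->
     let m := (a + b) / 2 in let k := (c + d) / 2 in
     P a m c k -> P a m k d -> P m b c k -> P m b k d -> P a b c d) ->
  (forall x y, a <= x <= b -> c <= y <= d ->
     exists delta : posreal, forall a' b' c' d',
       a <= a' <= x -> x <= b' <= b -> c <= c' <= y -> y <= d' <= d ->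
       b' - a' < delta -> d' - c' < delta -> P a' b' c' d') ->
  P a b c d.
Proof.
  intros Hab Hcd Hsplit Hloc.
  apply NNPP; intros Hbad.
  set (Bad := fun q : R * R * R * R =>
    let '(a', b', c', d') := q in
    a <= a' /\ a' <= b' /\ b' <= b /\ c <= c' /\ c' <= d' /\ d' <= d /\
    ~ P a' b' c' d').
  set (Half := fun q q' : R * R * R * R =>
    let '(a1, b1, c1, d1) := q in let '(a2, b2, c2, d2) := q' in
    a1 <= a2 /\ b2 <= b1 /\ b2 - a2 = (b1 - a1) / 2 /\
    c1 <= c2 /\ d2 <= d1 /\ d2 - c2 = (d1 - c1) / 2).
  assert (Hstep : forall q : {q | Bad q}, exists q' : {q | Bad q},
                    Half (proj1_sig q) (proj1_sig q')).
  { intros [[[[a1 b1] c1] d1] (H1 & H2 & H3 & H4 & H5 & H6 & H7)]; simpl.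
    apply NNPP; intros Hno.
    assert (Hchild : forall a2 b2 c2 d2,
      a1 <= a2 <= b2 -> b2 <= b1 -> b2 - a2 = (b1 - a1) / 2 ->
      c1 <= c2 <= d2 -> d2 <= d1 -> d2 - c2 = (d1 - c1) / 2 -> P a2 b2 c2 d2).
    { intros a2 b2 c2 d2 ? ? ? ? ? ?; apply NNPP; intros HP; apply Hno.
      assert (HB : Bad (a2, b2, c2, d2)) by (simpl; repeat split; trivial; lra).
      exists (exist _ _ HB); simpl; repeat split; lra. }
    apply H7, Hsplit; try assumption; apply Hchild; lra. }
  assert (HB0 : Bad (a, b, c, d)) by (simpl; repeat split; trivial; lra).
  (* The subset type makes each chosen rectangle carry its own badness, so the choice can be
     iterated. *)
  pose (next := fun q => proj1_sig
    (constructive_indefinite_description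
       (fun q' => Half (proj1_sig q) (proj1_sig q')) (Hstep q))).
  assert (Hnext : forall q, Half (proj1_sig q) (proj1_sig (next q))).
  { intros q; unfold next.
    match goal with |- context [proj1_sig (constructive_indefinite_description ?U ?h)] =>
      exact (proj2_sig (constructive_indefinite_description U h)) end. }
  pose (s := fix s n := match n with O => exist Bad _ HB0 | S n => next (s n) end).
  pose (A := fun n => fst (fst (fst (proj1_sig (s n))))).
  pose (B := fun n => snd (fst (fst (proj1_sig (s n))))).
  pose (C := fun n => snd (fst (proj1_sig (s n)))).
  pose (D := fun n => snd (proj1_sig (s n))).
  assert (HBad : forall n, a <= A n /\ A n <= B n /\ B n <= b /\
     c <= C n /\ C n <= D n /\ D n <= d /\ ~ P (A n) (B n) (C n) (D n)).
  { intros n; unfold A, B, C, D.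
    destruct (s n) as [[[[a1 b1] c1] d1] H]; exact H. }
  assert (HS : forall n, A n <= A (S n) /\ B (S n) <= B n /\
     B (S n) - A (S n) = (B n - A n) / 2 /\ C n <= C (S n) /\ D (S n) <= D n /\
     D (S n) - C (S n) = (D n - C n) / 2).
  { intros n; generalize (Hnext (s n)).
    change (next (s n)) with (s (S n)); unfold A, B, C, D.
    destruct (s n) as [[[[a1 b1] c1] d1] H].
    destruct (s (S n)) as [[[[a2 b2] c2] d2] H']; exact (fun h => h). }
  assert (Hsize : forall n, B n - A n = (b - a) * (1 / 2) ^ n /\
                            D n - C n = (d - c) * (1 / 2) ^ n).
  { induction n as [|n [IH1 IH2]].
    - unfold A, B, C, D; simpl; lra.
    - destruct (HS n) as (_ & _ & H1 & _ & _ & H2).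
      rewrite H1, H2, IH1, IH2; simpl; split; field. }
  (* Nested intervals: the supremum of the left ends lies in all of them. *)
  assert (Hnested : forall (U V : nat -> R), (forall n, U n <= U (S n)) ->
     (forall n, V (S n) <= V n) -> (forall n, U n <= V n) ->
     exists x, forall n, U n <= x <= V n).
  { intros U V HU HV HUV.
    assert (HUm : forall n m, (n <= m)%nat -> U n <= U m).
    { intros n m h; induction h; [lra | specialize (HU m); lra]. }
    assert (HVm : forall n m, (n <= m)%nat -> V m <= V n).
    { intros n m h; induction h; [lra | specialize (HV m); lra]. }
    assert (HUV' : forall n m, U n <= V m).
    { intros n m; apply Rle_trans with (U (max n m)); [apply HUm; lia|].
      apply Rle_trans with (V (max n m)); [apply HUV | apply HVm; lia]. }
    destruct (completeness (fun z => exists n, z = U n)) as [x [Hx1 Hx2]].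
    - exists (V O); intros z [n ->]; apply HUV'.
    - exists (U O), O; reflexivity.
    - exists x; intros n; split.
      + apply Hx1; exists n; reflexivity.
      + apply Hx2; intros z [m ->]; apply HUV'. }
  destruct (Hnested A B) as [x Hx]; try (intros n; apply (HS n) || apply (HBad n)).
  destruct (Hnested C D) as [y Hy]; try (intros n; apply (HS n) || apply (HBad n)).
  destruct (Hloc x y) as [delta Hdelta].
  { generalize (Hx O) (HBad O); lra. }
  { generalize (Hy O) (HBad O); lra. }
  (* After [N] halvings both sides are shorter than [delta]; the summand 1 keeps the denominator
     positive for a degenerate rectangle. *)
  destruct (pow_lt_1_zero (1 / 2)) with (y := delta / (1 + (b - a) + (d - c)))
    as [N HN].
  { rewrite Rabs_pos_eq; lra. }
  { apply Rdiv_lt_0_compat; [apply cond_pos | lra]. }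
  specialize (HN N (le_n N)).
  assert (Hpow : 0 < (1 / 2) ^ N) by (apply pow_lt; lra).
  rewrite Rabs_pos_eq in HN by lra.
  apply (Rmult_lt_compat_r (1 + (b - a) + (d - c))) in HN; [|lra].
  unfold Rdiv in HN at 2; rewrite Rmult_assoc, Rinv_l, Rmult_1_r in HN by lra.
  destruct (HBad N) as (? & ? & ? & ? & ? & ? & HP).
  destruct (Hsize N) as [HsA HsC].
  apply HP, Hdelta; generalize (Hx N) (Hy N); lra.
Qed.

Lemma differentiable_pt_lim_continuous (f : R -> R -> R) (x y lx ly : R) :
  differentiable_pt_lim f x y lx ly -> continuity_2d_pt f x y.
Proof.
  intros H; apply differentiable_continuity_pt; exists lx, ly; exact H.
Qed.

Lemma continuity_2d_pt_fst (f : R -> R -> R) (x y : R) :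
  continuity_2d_pt f x y -> continuous (fun u => f u y) x.
Proof.
  intros H P [e He].
  destruct (H e) as [d Hd]; exists d; intros u Hu; apply He.
  apply Hd; [exact Hu | rewrite Rminus_diag, Rabs_R0; apply cond_pos].
Qed.

Lemma continuity_2d_pt_snd (f : R -> R -> R) (x y : R) :
  continuity_2d_pt f x y -> continuous (fun v => f x v) y.
Proof.
  intros H P [e He].
  destruct (H e) as [d Hd]; exists d; intros u Hu; apply He.
  apply Hd; [rewrite Rminus_diag, Rabs_R0; apply cond_pos | exact Hu].
Qed.

(** The line integral of p ds + q dt counterclockwise along the boundary of [a, b] x [c, d]. *)
Definition circulation (p q : R -> R -> R) (a b c d : R) : R :=
  (RInt (q b) c d - RInt (q a) c d) -
  (RInt (fun s => p s d) a b - RInt (fun s => p s c) a b).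

(* Goursat's argument: only pointwise differentiability is available, so the
   equality of mixed partials is used through rectangles shrinking to a point. *)
Lemma circulation_eq_0 (p q : R -> R -> R) (a b c d : R) :
  a <= b -> c <= d ->
  (forall s t, a <= s <= b -> c <= t <= d ->
     exists k l m, differentiable_pt_lim p s t k l /\
                   differentiable_pt_lim q s t l m) ->
  circulation p q a b c d = 0.
Proof.
  intros Hab Hcd Hdiff.
  assert (Ip : forall t u v, c <= t <= d -> a <= u <= v -> v <= b ->
            ex_RInt (fun s => p s t) u v).
  { intros t u v Ht Hu Hv; apply (ex_RInt_continuous (V := R_CompleteNormedModule)); intros z.
    rewrite Rmin_left, Rmax_right by lra; intros Hz.
    destruct (Hdiff z t) as (k & l & m & Hp & _); [lra | lra |].
    apply continuity_2d_pt_fst, (differentiable_pt_lim_continuous _ _ _ _ _ Hp). }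
  assert (Iq : forall s u v, a <= s <= b -> c <= u <= v -> v <= d ->
            ex_RInt (q s) u v).
  { intros s u v Hs Hu Hv; apply (ex_RInt_continuous (V := R_CompleteNormedModule)); intros z.
    rewrite Rmin_left, Rmax_right by lra; intros Hz.
    destruct (Hdiff s z) as (k & l & m & _ & Hq); [lra | lra |].
    apply continuity_2d_pt_snd, (differentiable_pt_lim_continuous _ _ _ _ _ Hq). }
  (* The sum of the squared sides is preserved in total when a rectangle is cut into four halves in
     each direction, and, unlike the area, it controls thin rectangles. The inclusions are premises
     of [P] because the bisection step ranges over all rectangles. *)
  set (P := fun eps a' b' c' d' : R =>
    a <= a' -> b' <= b -> c <= c' -> d' <= d ->
    Rabs (circulation p q a' b' c' d') <=
    eps * ((b' - a') ^ 2 + (d' - c') ^ 2)).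
  assert (HP : forall eps, 0 < eps -> P eps a b c d).
  { intros eps Heps; apply rectangle_bisection; trivial.
    - intros a1 b1 c1 d1 h1 h2 m k H1 H2 H3 H4 h3 h4 h5 h6.
      assert (a1 <= m <= b1) by (unfold m; lra).
      assert (c1 <= k <= d1) by (unfold k; lra).
      specialize (H1 ltac:(lra) ltac:(lra) ltac:(lra) ltac:(lra)).
      specialize (H2 ltac:(lra) ltac:(lra) ltac:(lra) ltac:(lra)).
      specialize (H3 ltac:(lra) ltac:(lra) ltac:(lra) ltac:(lra)).
      specialize (H4 ltac:(lra) ltac:(lra) ltac:(lra) ltac:(lra)).
      replace (circulation p q a1 b1 c1 d1) with
        (circulation p q a1 m c1 k + circulation p q a1 m k d1 +
         (circulation p q m b1 c1 k + circulation p q m b1 k d1)).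
      + eapply Rle_trans; [apply Rabs_triang|].
        eapply Rle_trans;
          [apply Rplus_le_compat; (eapply Rle_trans; [apply Rabs_triang|]);
           apply Rplus_le_compat; eassumption|].
        right; unfold m, k; field.
      + unfold circulation.
        rewrite <- (RInt_Chasles (q b1) c1 k d1) by (apply Iq; lra).
        rewrite <- (RInt_Chasles (q a1) c1 k d1) by (apply Iq; lra).
        rewrite <- (RInt_Chasles (fun s => p s d1) a1 m b1) by (apply Ip; lra).
        rewrite <- (RInt_Chasles (fun s => p s c1) a1 m b1) by (apply Ip; lra).
        unfold plus; simpl; ring.
    - intros s t Hs Ht.
      destruct (Hdiff s t Hs Ht) as (k & l & m & Hp & Hq).
      (* Two opposite sides each contribute eps/4, so their difference is off by eps/2 (L + M)
         pointwise. *)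
      assert (He : 0 < eps / 4) by lra.
      destruct (Hp (mkposreal _ He)) as [d1 H1].
      destruct (Hq (mkposreal _ He)) as [d2 H2].
      simpl in H1, H2.
      exists (mkposreal _ (Rmin_stable_in_posreal d1 d2)).
      intros a' b' c' d' Ha Hb Hc Hd Hba Hdc _ _ _ _; simpl in Hba, Hdc.
      set (L := b' - a'); set (M := d' - c').
      assert (Hd1 := Rmin_l d1 d2); assert (Hd2 := Rmin_r d1 d2).
      assert (HLM : forall u v, a' <= u <= b' -> c' <= v <= d' ->
         Rabs (u - s) < d1 /\ Rabs (v - t) < d1 /\
         Rabs (u - s) < d2 /\ Rabs (v - t) < d2 /\
         Rmax (Rabs (u - s)) (Rabs (v - t)) <= L + M).
      { intros u v Hu Hv.
        assert (Rabs (u - s) <= L) by (apply Rabs_le; unfold L; lra).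
        assert (Rabs (v - t) <= M) by (apply Rabs_le; unfold M; lra).
        assert (0 <= L) by (unfold L; lra).
        assert (0 <= M) by (unfold M; lra).
        fold L in Hba; fold M in Hdc.
        repeat split; try lra.
        apply Rmax_lub; lra. }
      assert (Ep : forall u v, a' <= u <= b' -> c' <= v <= d' ->
         Rabs (p u v - p s t - (k * (u - s) + l * (v - t))) <= eps / 4 * (L + M)).
      { intros u v Hu Hv; destruct (HLM u v Hu Hv) as (? & ? & ? & ? & ?).
        eapply Rle_trans; [apply H1; assumption|].
        apply Rmult_le_compat_l; lra. }
      assert (Eq : forall u v, a' <= u <= b' -> c' <= v <= d' ->
         Rabs (q u v - q s t - (l * (u - s) + m * (v - t))) <= eps / 4 * (L + M)).
      { intros u v Hu Hv; destruct (HLM u v Hu Hv) as (? & ? & ? & ? & ?).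
        eapply Rle_trans; [apply H2; assumption|].
        apply Rmult_le_compat_l; lra. }
      (* To first order, the [q] sides and the [p] sides both contribute L l M, since the
         s-derivative of [q] and the t-derivative of [p] are the same [l]; these main terms cancel
         below. *)
      assert (Bq : Rabs (RInt (q b') c' d' - RInt (q a') c' d' - L * l * M) <=
                   M * (eps / 2 * (L + M))).
      { replace (L * l * M) with (RInt (fun _ => L * l) c' d')
          by (rewrite RInt_const; unfold scal; simpl; unfold mult; simpl;
              unfold M; ring).
        assert (Ic : ex_RInt (fun _ : R => L * l) c' d') by apply ex_RInt_const.
        assert (Ib : ex_RInt (q b') c' d') by (apply Iq; lra).
        assert (Ia : ex_RInt (q a') c' d') by (apply Iq; lra).
        assert (Iba := ex_RInt_minus _ _ _ _ Ib Ia).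
        change (Rabs (minus (minus (RInt (q b') c' d') (RInt (q a') c' d'))
                  (RInt (fun _ => L * l) c' d')) <= M * (eps / 2 * (L + M))).
        rewrite <- (RInt_minus (V := R_CompleteNormedModule)) by assumption.
        rewrite <- (RInt_minus (V := R_CompleteNormedModule)) by assumption.
        apply abs_RInt_le_const; [lra | apply (ex_RInt_minus (V := R_CompleteNormedModule)); assumption |].
        intros v Hv.
        assert (E1 := Eq b' v ltac:(lra) Hv); assert (E2 := Eq a' v ltac:(lra) Hv).
        unfold minus, plus, opp; simpl.
        apply Rabs_le_between in E1; apply Rabs_le_between in E2.
        apply Rabs_le; unfold L in *; lra. }
      assert (Bp : Rabs (RInt (fun s => p s d') a' b' - RInt (fun s => p s c') a' b'
                     - L * l * M) <= L * (eps / 2 * (L + M))).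
      { replace (L * l * M) with (RInt (fun _ => M * l) a' b')
          by (rewrite RInt_const; unfold scal; simpl; unfold mult; simpl;
              unfold L; ring).
        assert (Ic : ex_RInt (fun _ : R => M * l) a' b') by apply ex_RInt_const.
        assert (Ib : ex_RInt (fun s => p s d') a' b') by (apply Ip; lra).
        assert (Ia : ex_RInt (fun s => p s c') a' b') by (apply Ip; lra).
        assert (Iba := ex_RInt_minus _ _ _ _ Ib Ia).
        change (Rabs (minus (minus (RInt (fun s => p s d') a' b')
                  (RInt (fun s => p s c') a' b'))
                  (RInt (fun _ => M * l) a' b')) <= L * (eps / 2 * (L + M))).
        rewrite <- (RInt_minus (V := R_CompleteNormedModule)) by assumption.
        rewrite <- (RInt_minus (V := R_CompleteNormedModule)) by assumption.
        apply abs_RInt_le_const; [lra | apply (ex_RInt_minus (V := R_CompleteNormedModule)); assumption |].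
        intros v Hv.
        assert (E1 := Ep v d' Hv ltac:(lra)); assert (E2 := Ep v c' Hv ltac:(lra)).
        unfold minus, plus, opp; simpl.
        apply Rabs_le_between in E1; apply Rabs_le_between in E2.
        apply Rabs_le; unfold M in *; lra. }
      unfold circulation.
      replace (_ - _) with
        ((RInt (q b') c' d' - RInt (q a') c' d' - L * l * M) -
         (RInt (fun s => p s d') a' b' - RInt (fun s => p s c') a' b' - L * l * M))
        by ring.
      apply Rabs_le_between in Bq; apply Rabs_le_between in Bp.
      apply Rabs_le.
      (* The errors add up to eps/2 (L + M)^2, which is at most eps (L^2 + M^2) by this square. *)
      assert (0 <= eps * (L - M) ^ 2)
        by (apply Rmult_le_pos; [lra | apply pow2_ge_0]).
      nra. }
  apply NNPP; intros H0.
  set (S := (b - a) ^ 2 + (d - c) ^ 2).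
  assert (HS : 0 <= S) by (unfold S; generalize (pow2_ge_0 (b - a)) (pow2_ge_0 (d - c)); lra).
  apply Rabs_pos_lt in H0.
  (* With this eps the bound reads E <= E S / (2 (1 + S)), which is less than E; the 1 covers S =
     0. *)
  assert (He : 0 < Rabs (circulation p q a b c d) / (2 * (1 + S)))
    by (apply Rdiv_lt_0_compat; lra).
  specialize (HP _ He ltac:(lra) ltac:(lra) ltac:(lra) ltac:(lra)).
  fold S in HP.
  set (E := Rabs (circulation p q a b c d)) in *.
  apply (Rmult_le_compat_r (2 * (1 + S))) in HP; [|lra].
  replace (E / (2 * (1 + S)) * S * (2 * (1 + S))) with (E * S) in HP
    by (field; lra).
  nra.
Qed.

(** * Complex limits and derivatives *)

Local Notation ex_derive_C := (@ex_derive C_AbsRing C_NormedModule).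
Local Notation is_derive_C := (@is_derive C_AbsRing C_NormedModule).

(** Limits are taken in the product structure on the plane and derivatives in the one given by the
    modulus; both have the same neighbourhoods. *)
Lemma locally_Cmod (z : C) (P : C -> Prop) :
  locally (T := C_UniformSpace) z P <->
  exists d : posreal, forall y : C, Cmod (y - z) < d -> P y.
Proof.
  rewrite locally_C; reflexivity.
Qed.

Lemma filterlim_Cmod {T : Type} (F : (T -> Prop) -> Prop) {FF : Filter F}
  (f : T -> C) (l : C) :
  filterlim f F (locally (T := C_UniformSpace) l) <->
  forall eps : posreal, F (fun x => Cmod (f x - l) < eps).
Proof.
  split.
  - intros H eps; apply (H (fun y => Cmod (y - l) < eps)).
    apply locally_Cmod; exists eps; trivial.
  - intros H P HP; apply locally_Cmod in HP; destruct HP as [d Hd].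
    apply filter_imp with (2 := H d); intros x; apply Hd.
Qed.

Lemma filterlim_Cmult {T : Type} (F : (T -> Prop) -> Prop) {FF : Filter F}
  (f g : T -> C) (lf lg : C) :
  filterlim f F (locally (T := C_UniformSpace) lf) ->
  filterlim g F (locally (T := C_UniformSpace) lg) ->
  filterlim (fun x => f x * g x)%C F (locally (T := C_UniformSpace) (lf * lg)%C).
Proof.
  intros Hf Hg; apply filterlim_locally; intros eps.
  assert (H := filterlim_comp_2 f g (fun x y => mult (K := C_AbsRing) x y)
    (F := F) (G := locally (T := AbsRing_UniformSpace C_AbsRing) lf)
    (H := locally (T := AbsRing_UniformSpace C_AbsRing) lg)
    (I := locally (T := AbsRing_UniformSpace C_AbsRing) (mult lf lg))).
  apply H.
  - intros P HP; apply Hf, locally_C, HP.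
  - intros P HP; apply Hg, locally_C, HP.
  - apply (filterlim_mult (K := C_AbsRing)).
  - apply locally_C; exists eps; trivial.
Qed.

Lemma filterlim_Cplus {T : Type} (F : (T -> Prop) -> Prop) {FF : Filter F}
  (f g : T -> C) (lf lg : C) :
  filterlim f F (locally (T := C_UniformSpace) lf) ->
  filterlim g F (locally (T := C_UniformSpace) lg) ->
  filterlim (fun x => f x + g x)%C F (locally (T := C_UniformSpace) (lf + lg)%C).
Proof.
  intros Hf Hg.
  apply (filterlim_comp_2 f g (fun x y => plus (G := C_NormedModule) x y) Hf Hg).
  apply (filterlim_plus (V := C_NormedModule)).
Qed.

Lemma filterlim_Copp {T : Type} (F : (T -> Prop) -> Prop) {FF : Filter F}
  (f : T -> C) (lf : C) :
  filterlim f F (locally (T := C_UniformSpace) lf) ->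
  filterlim (fun x => - f x)%C F (locally (T := C_UniformSpace) (- lf)%C).
Proof.
  intros Hf; eapply filterlim_comp; [exact Hf|].
  apply (filterlim_opp (V := C_NormedModule)).
Qed.

Lemma is_derive_C_iff (f : C -> C) (z l : C) :
  is_derive_C f z l <->
  forall eps : posreal, exists d : posreal, forall y : C, Cmod (y - z) < d ->
    Cmod (f y - f z - l * (y - z)) <= eps * Cmod (y - z).
Proof.
  split.
  - intros [_ H] eps.
    destruct (H z (fun P HP => HP) eps) as [d Hd].
    exists d; intros y Hy; specialize (Hd y Hy).
    change (Cmod (f y - f z - (y - z) * l) <= eps * Cmod (y - z)) in Hd.
    rewrite Cmult_comm; exact Hd.
  - intros H; split; [apply is_linear_scal_l|].
    intros x Hx eps.
    apply (is_filter_lim_locally_unique (V := AbsRing_NormedModule C_AbsRing)) in Hx.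
    subst x; destruct (H eps) as [d Hd].
    exists d; intros y Hy; specialize (Hd y Hy).
    change (Cmod (f y - f z - (y - z) * l) <= eps * Cmod (y - z)).
    rewrite Cmult_comm; exact Hd.
Qed.

Lemma is_derive_Cinv (z : C) :
  z <> 0%C ->
  is_derive_C Cinv z (- / (z * z))%C.
Proof.
  intros Hz; apply is_derive_C_iff; intros eps.
  assert (Hm : 0 < Cmod z) by (apply Cmod_gt_0; exact Hz).
  (* The error is (y - z)^2 / (y z^2). The first bound keeps |y| above |z|/2, hence |y z^2| above
     |z|^3/2; the second then absorbs one factor y - z. *)
  assert (Hd : 0 < Rmin (Cmod z / 2) (eps * (Cmod z ^ 3 / 2))).
  { apply Rmin_pos; [lra|].
    apply Rmult_lt_0_compat; [apply cond_pos|].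
    generalize (pow_lt _ 3 Hm); lra. }
  exists (mkposreal _ Hd); simpl pos; intros y Hy.
  assert (Hy1 := Rlt_le_trans _ _ _ Hy (Rmin_l _ _)).
  assert (Hy2 := Rlt_le_trans _ _ _ Hy (Rmin_r _ _)).
  assert (Hym : Cmod z / 2 < Cmod y).
  { generalize (Cmod_triangle y (- (y - z))%C); rewrite Cmod_opp.
    replace (y + - (y - z))%C with z by ring; lra. }
  assert (Hy0 : y <> 0%C) by (apply Cmod_gt_0; lra).
  replace (/ y - / z - - / (z * z) * (y - z))%C
    with ((y - z) * (y - z) / (y * (z * z)))%C by (field; auto).
  rewrite Cmod_div, !Cmod_mult by (repeat apply Cmult_neq_0; assumption).
  set (h := Cmod (y - z)) in *; set (m := Cmod z) in *; set (k := Cmod y) in *.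
  assert (0 <= h) by apply Cmod_ge_0.
  assert (Hkm : m ^ 3 / 2 <= k * (m * m))
    by (assert (0 < m * m) by nra; simpl; nra).
  assert (0 < k * (m * m)) by (generalize (pow_lt _ 3 Hm); lra).
  apply Rmult_le_reg_r with (k * (m * m)); [assumption|].
  unfold Rdiv; rewrite Rmult_assoc, Rinv_l, Rmult_1_r by lra.
  rewrite (Rmult_comm eps), Rmult_assoc; apply Rmult_le_compat_l; [assumption|].
  apply Rle_trans with (1 := Rlt_le _ _ Hy2).
  apply Rmult_le_compat_l; [apply Rlt_le, cond_pos | exact Hkm].
Qed.

Lemma ex_derive_C_continuous (f : C -> C) (z : C) :
  ex_derive_C f z ->
  filterlim f (locally (T := C_UniformSpace) z) (locally (T := C_UniformSpace) (f z)).
Proof.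
  intros H P HP; apply locally_C.
  exact (ex_derive_continuous (K := C_AbsRing) (V := C_NormedModule) f z H P HP).
Qed.

Definition Ccontinuous (f : C -> C) (z : C) : Prop :=
  filterlim f (locally (T := C_UniformSpace) z) (locally (T := C_UniformSpace) (f z)).

(** With [l] the derivative of [f] at [w], this fills the removable singularity continuously;
    differentiability at [w] itself is never claimed. *)
Definition difference_quotient (f : C -> C) (w l z : C) : C :=
  if Ceq_dec z w then l else ((f z - f w) * / (z - w))%C.

Lemma difference_quotient_continuous_base (f : C -> C) (w l : C) :
  is_derive_C f w l ->
  Ccontinuous (difference_quotient f w l) w.
Proof.
  intros Hl; apply filterlim_Cmod; [apply locally_filter|].
  intros eps.
  (* The derivative gives a weak inequality; halving makes it strict. *)
  assert (He : 0 < eps / 2) by (generalize (cond_pos eps); lra).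
  destruct (proj1 (is_derive_C_iff f w l) Hl (mkposreal _ He)) as [d Hd].
  apply locally_Cmod; exists d; intros y Hy; specialize (Hd y Hy); simpl in Hd.
  unfold difference_quotient.
  destruct (Ceq_dec w w) as [_|]; [|contradiction].
  destruct (Ceq_dec y w) as [->|Hyw].
  { replace (l - l)%C with (RtoC 0) by ring; rewrite Cmod_0; apply cond_pos. }
  assert (Hyw' : (y - w)%C <> 0%C).
  { intros H; apply Hyw; replace y with (y - w + w)%C by ring; rewrite H; ring. }
  replace ((f y - f w) * / (y - w) - l)%C
    with ((f y - f w - l * (y - w)) / (y - w))%C by (field; exact Hyw').
  rewrite Cmod_div by exact Hyw'.
  apply Cmod_gt_0 in Hyw'.
  apply Rmult_lt_reg_r with (Cmod (y - w)); [assumption|].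
  unfold Rdiv; rewrite Rmult_assoc, Rinv_l, Rmult_1_r by lra.
  nra.
Qed.

Lemma locally_neq_C (z w : C) : z <> w -> locally (T := C_UniformSpace) z (fun y => y <> w).
Proof.
  intros H; apply locally_Cmod.
  assert (Hd : 0 < Cmod (w - z)).
  { apply Cmod_gt_0; intros H'; apply H.
    replace w with (w - z + z)%C by ring; rewrite H'; ring. }
  exists (mkposreal _ Hd); simpl; intros y Hy ->; lra.
Qed.

Lemma difference_quotient_ext (f : C -> C) (w l z : C) :
  z <> w ->
  difference_quotient f w l z = ((f z - f w) * / (z - w))%C.
Proof.
  intros H; unfold difference_quotient; destruct (Ceq_dec z w); tauto.
Qed.

Lemma is_derive_Cinv_sub (w z : C) :
  z <> w ->
  ex_derive_C (fun y => / (y - w))%C z.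
Proof.
  intros H.
  apply (ex_derive_comp (K := C_AbsRing) (V := C_NormedModule) Cinv (fun y => (y - w)%C)).
  - eexists; apply is_derive_Cinv; intros H'; apply H.
    replace z with (z - w + w)%C by ring; rewrite H'; ring.
  - apply (ex_derive_minus (K := C_AbsRing) (V := AbsRing_NormedModule C_AbsRing)).
    + apply ex_derive_id.
    + apply ex_derive_const.
Qed.

Lemma difference_quotient_continuous (f : C -> C) (w l z : C) :
  z <> w -> Ccontinuous f z -> Ccontinuous (difference_quotient f w l) z.
Proof.
  intros Hz Hf; unfold Ccontinuous; rewrite difference_quotient_ext by exact Hz.
  apply (filterlim_ext_loc (fun y => (f y + - f w) * / (y - w))%C).
  - apply filter_imp with (2 := locally_neq_C z w Hz); intros y Hy.
    symmetry; apply (difference_quotient_ext f w l y Hy).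
  - apply filterlim_Cmult; [apply locally_filter| |].
    + apply filterlim_Cplus; [apply locally_filter | exact Hf | apply filterlim_const].
    + exact (ex_derive_C_continuous _ _ (is_derive_Cinv_sub w z Hz)).
Qed.

(** The product rule is stated for the module structure coming from the absolute ring. The estimates
    are the same in [C_NormedModule], so only the linearity component is rebuilt. *)
Lemma ex_derive_Cmult (f g : C -> C) (z : C) :
  ex_derive_C f z ->
  ex_derive_C g z ->
  ex_derive_C (fun y => f y * g y)%C z.
Proof.
  intros [lf Hf] [lg Hg].
  exists (plus (mult (K := C_AbsRing) lf (g z)) (mult (K := C_AbsRing) (f z) lg)).
  assert (Hf' : is_derive (K := C_AbsRing) (V := AbsRing_NormedModule C_AbsRing) f z lf)
    by (split; [apply is_linear_scal_l | exact (proj2 Hf)]).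
  assert (Hg' : is_derive (K := C_AbsRing) (V := AbsRing_NormedModule C_AbsRing) g z lg)
    by (split; [apply is_linear_scal_l | exact (proj2 Hg)]).
  split; [apply is_linear_scal_l|].
  exact (proj2 (is_derive_mult (K := C_AbsRing) f g z lf lg Hf' Hg' Cmult_comm)).
Qed.

Lemma difference_quotient_ex_derive (f : C -> C) (w l z : C) :
  z <> w ->
  ex_derive_C f z ->
  ex_derive_C (difference_quotient f w l) z.
Proof.
  intros Hz Hf.
  apply (ex_derive_ext_loc (K := C_AbsRing) (V := C_NormedModule)
           (fun y => (f y - f w) * / (y - w))%C).
  - apply locally_C; apply filter_imp with (2 := locally_neq_C z w Hz); intros y Hy.
    symmetry; apply (difference_quotient_ext f w l y Hy).
  - apply ex_derive_Cmult; [|apply is_derive_Cinv_sub, Hz].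
    apply (ex_derive_minus (K := C_AbsRing) (V := C_NormedModule));
      [exact Hf | apply ex_derive_const].
Qed.

(** * Functions continuous across the unit circle *)

(** Uniform continuity on the compact set [r - 1, r + 1] x [c, d] controls the integrand for all [t]
    at once. *)
Lemma continuity_pt_RInt_param (k : R -> R -> R) (c d : R) :
  c <= d ->
  (forall r t, continuity_2d_pt k r t) ->
  forall r, continuity_pt (fun r => RInt (k r) c d) r.
Proof.
  intros Hcd Hk r.
  assert (Ik : forall s, ex_RInt (k s) c d).
  { intros s; apply (ex_RInt_continuous (V := R_CompleteNormedModule)).
    intros t _; apply continuity_2d_pt_snd, Hk. }
  intros eps Heps.
  assert (He : 0 < eps / (1 + (d - c))) by (apply Rdiv_lt_0_compat; lra).
  destruct (uniform_continuity_2d k (r - 1) (r + 1) c d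
              (fun x y _ _ => Hk x y) (mkposreal _ He)) as [e H]; simpl in H.
  exists (Rmin e 1); split; [apply Rmin_pos; [apply cond_pos | lra]|].
  intros x [_ Hx]; simpl in *; unfold Rdist in *.
  assert (Hx1 := Rlt_le_trans _ _ _ Hx (Rmin_l _ _)).
  assert (Hx2 := Rlt_le_trans _ _ _ Hx (Rmin_r _ _)).
  apply Rabs_def2 in Hx2.
  change (Rabs (minus (RInt (k x) c d) (RInt (k r) c d)) < eps).
  rewrite <- (RInt_minus (V := R_CompleteNormedModule)) by apply Ik.
  apply Rle_lt_trans with ((d - c) * (eps / (1 + (d - c)))).
  - apply abs_RInt_le_const; trivial.
    + apply (ex_RInt_minus (V := R_CompleteNormedModule)); apply Ik.
    + intros t Ht; apply Rlt_le, H; try lra.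
      rewrite Rminus_diag, Rabs_R0; apply cond_pos.
  - replace eps with ((1 + (d - c)) * (eps / (1 + (d - c)))) at 2 by (field; lra).
    apply Rmult_lt_compat_r; lra.
Qed.

(** The mean value theorem asks for a derivative only inside the interval; continuity reaches the
    end points, here the radii where differentiability may fail. *)
Lemma constant_of_open_interval (J : R -> R) (a b : R) :
  a < b ->
  (forall x, continuity_pt J x) ->
  (forall x y, a < x < y -> y < b -> J x = J y) ->
  J b = J a.
Proof.
  intros Hab HJ Hc.
  destruct (MVT_gen J a b (fun _ => 0)) as (_ & _ & H).
  - rewrite Rmin_left, Rmax_right by lra; intros x Hx.
    apply (is_derive_ext_loc (fun _ => J x)).
    + assert (Hd : 0 < Rmin (x - a) (b - x)) by (apply Rmin_pos; lra).
      exists (mkposreal _ Hd); intros y Hy.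
      apply Rabs_def2 in Hy; simpl in Hy; unfold minus, plus, opp in Hy; simpl in Hy.
      generalize (Rmin_l (x - a) (b - x)) (Rmin_r (x - a) (b - x)); intros ? ?.
      destruct (Rtotal_order x y) as [h | [-> | h]]; [| reflexivity |].
      * apply Hc; lra.
      * symmetry; apply Hc; lra.
    + apply (is_derive_const (V := R_NormedModule)).
  - intros x _; apply HJ.
  - lra.
Qed.

(** * Integrals over circles in polar coordinates *)

Definition polar (r t : R) : C := (r * cos t, r * sin t).

Lemma Cmod_polar (r t : R) : 0 <= r -> Cmod (polar r t) = r.
Proof.
  intros Hr; unfold Cmod, polar; simpl.
  replace (_ + _) with (r ^ 2 * (Rsqr (sin t) + Rsqr (cos t))) by (unfold Rsqr; ring).
  rewrite sin2_cos2, Rmult_1_r; apply sqrt_pow2, Hr.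
Qed.

(* The real part of [g(z) dz / (i dt)] along the circle of radius [r]. *)
Definition angular_part (g : C -> C) (r t : R) : R :=
  Re (g (polar r t) * polar r t)%C.

(* The real part of [g(z) dz / (i dr)] along the ray of angle [t]. *)
Definition radial_part (g : C -> C) (r t : R) : R :=
  Im (g (polar r t) * polar 1 t)%C.

Lemma differentiable_pt_lim_Rmult (f g : R -> R -> R) (x y fx fy gx gy : R) :
  differentiable_pt_lim f x y fx fy ->
  differentiable_pt_lim g x y gx gy ->
  differentiable_pt_lim (fun u v => f u v * g u v) x y
    (fx * g x y + f x y * gx) (fy * g x y + f x y * gy).
Proof.
  intros Hf Hg.
  apply filterdiff_differentiable_pt_lim in Hf.
  apply filterdiff_differentiable_pt_lim in Hg.
  apply (filterdiff_differentiable_pt_lim (fun u v => f u v * g u v)).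
  eapply filterdiff_ext_lin.
  - apply (filterdiff_mult_fct (K := R_AbsRing) (fun u : R * R => f (fst u) (snd u))
        (fun u : R * R => g (fst u) (snd u)) (x, y) _ _ Rmult_comm Hf Hg).
  - intros [u v]; simpl; unfold plus, mult; simpl; ring.
Qed.

Lemma differentiable_pt_lim_Rplus (f g : R -> R -> R) (x y fx fy gx gy : R) :
  differentiable_pt_lim f x y fx fy ->
  differentiable_pt_lim g x y gx gy ->
  differentiable_pt_lim (fun u v => f u v + g u v) x y (fx + gx) (fy + gy).
Proof.
  intros Hf Hg.
  apply filterdiff_differentiable_pt_lim in Hf.
  apply filterdiff_differentiable_pt_lim in Hg.
  apply (filterdiff_differentiable_pt_lim (fun u v => f u v + g u v)).
  eapply filterdiff_ext_lin.
  - apply (filterdiff_plus_fct (K := R_AbsRing) (fun u : R * R => f (fst u) (snd u))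
        (fun u : R * R => g (fst u) (snd u)) _ _ Hf Hg).
  - intros [u v]; simpl; unfold plus; simpl; ring.
Qed.

Lemma differentiable_pt_lim_fst (f : R -> R) (x y l : R) :
  is_derive f x l -> differentiable_pt_lim (fun u _ => f u) x y l 0.
Proof.
  intros H; apply differentiable_pt_lim_proj1_0, is_derive_Reals, H.
Qed.

Lemma differentiable_pt_lim_snd (f : R -> R) (x y l : R) :
  is_derive f y l -> differentiable_pt_lim (fun _ v => f v) x y 0 l.
Proof.
  intros H eps; destruct (differentiable_pt_lim_fst f y x l H eps) as [d Hd].
  exists d; intros u v Hu Hv; specialize (Hd v u Hv Hu).
  rewrite Rmax_comm.
  replace (0 * (u - x) + l * (v - y)) with (l * (v - y) + 0 * (u - x)) by ring.
  exact Hd.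
Qed.

Lemma Cauchy_Riemann (g : C -> C) (x y : R) (l : C) :
  is_derive_C g (x, y) l ->
  differentiable_pt_lim (fun u v => Re (g (u, v))) x y (Re l) (- Im l) /\
  differentiable_pt_lim (fun u v => Im (g (u, v))) x y (Im l) (Re l).
Proof.
  intros H.
  assert (Hc : forall eps : posreal, locally_2d (fun u v =>
     Cmod (g (u, v) - g (x, y) - l * ((u, v) - (x, y)))
       <= eps * Rmax (Rabs (u - x)) (Rabs (v - y))) x y).
  { assert (Hs : 0 < sqrt 2) by (apply sqrt_lt_R0; lra).
    intros eps.
    (* The modulus is at most sqrt 2 times the larger coordinate, so both the error and the radius
       are divided by sqrt 2. *)
    assert (He : 0 < eps / sqrt 2) by (apply Rdiv_lt_0_compat; [apply cond_pos | exact Hs]).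
    destruct (proj1 (is_derive_C_iff _ _ _) H (mkposreal _ He)) as [d Hd]; simpl in Hd.
    assert (Hd2 : 0 < d / sqrt 2) by (apply Rdiv_lt_0_compat; [apply cond_pos | exact Hs]).
    exists (mkposreal _ Hd2); simpl; intros u v Hu Hv.
    assert (Hm := Cmod_2Rmax ((u, v) - (x, y))%C); simpl in Hm.
    change (u + - x) with (u - x) in Hm; change (v + - y) with (v - y) in Hm.
    eapply Rle_trans; [apply Hd|].
    - apply Rle_lt_trans with (1 := Hm).
      apply Rlt_le_trans with (sqrt 2 * (d / sqrt 2)).
      + apply Rmult_lt_compat_l; [exact Hs|]; apply Rmax_lub_lt; assumption.
      + right; field; lra.
    - apply Rle_trans with (eps / sqrt 2 * (sqrt 2 * Rmax (Rabs (u - x)) (Rabs (v - y)))).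
      + apply Rmult_le_compat_l; lra.
      + right; field; lra. }
  split; intros eps; destruct (Hc eps) as [d Hd]; exists d; intros u v Hu Hv;
    (eapply Rle_trans; [|apply (Hd u v Hu Hv)]);
    (eapply Rle_trans; [|apply Rmax_Cmod]).
  - eapply Rle_trans; [|apply Rmax_l]; right; f_equal.
    destruct (g (u, v)), (g (x, y)), l; simpl; ring.
  - eapply Rle_trans; [|apply Rmax_r]; right; f_equal.
    destruct (g (u, v)), (g (x, y)), l; simpl; ring.
Qed.

(** The shared [l] expresses that g(z) dz is closed: both mixed derivatives equal the real part of
    g'(z) r e^(2it) + g(z) e^(it). *)
Lemma polar_parts_differentiable (g : C -> C) (r t : R) :
  ex_derive_C g (polar r t) ->
  exists k l m, differentiable_pt_lim (radial_part g) r t k l /\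
                differentiable_pt_lim (angular_part g) r t l m.
Proof.
  intros [l Hl].
  destruct (Cauchy_Riemann g _ _ l Hl) as [Hu Hv].
  assert (Hr := differentiable_pt_lim_fst (fun u => u) r t 1 (is_derive_id r)).
  assert (Hc := differentiable_pt_lim_snd cos r t (- sin t) (is_derive_cos t)).
  assert (Hs := differentiable_pt_lim_snd sin r t (cos t) (is_derive_sin t)).
  assert (Hx := differentiable_pt_lim_Rmult _ _ _ _ _ _ _ _ Hr Hc).
  assert (Hy := differentiable_pt_lim_Rmult _ _ _ _ _ _ _ _ Hr Hs).
  cbv beta in Hx, Hy.
  assert (HU := differentiable_pt_lim_comp (fun u v => Re (g (u, v))) _ _ r t _ _ _ _ _ _ Hu Hx Hy).
  assert (HV := differentiable_pt_lim_comp (fun u v => Im (g (u, v))) _ _ r t _ _ _ _ _ _ Hv Hx Hy).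
  assert (Hp := differentiable_pt_lim_Rplus _ _ _ _ _ _ _ _
     (differentiable_pt_lim_Rmult _ _ _ _ _ _ _ _ HU Hs)
     (differentiable_pt_lim_Rmult _ _ _ _ _ _ _ _ HV Hc)).
  (* The minus sign in the real part of a product is handled as multiplication by a constant
     function. *)
  assert (Hn := differentiable_pt_lim_fst (fun _ => -1) r t 0
                  (is_derive_const (V := R_NormedModule) (-1) r)).
  assert (Hq := differentiable_pt_lim_Rmult _ _ _ _ _ _ _ _ Hr
    (differentiable_pt_lim_Rplus _ _ _ _ _ _ _ _
     (differentiable_pt_lim_Rmult _ _ _ _ _ _ _ _ HU Hc)
     (differentiable_pt_lim_Rmult _ _ _ _ _ _ _ _ Hn
       (differentiable_pt_lim_Rmult _ _ _ _ _ _ _ _ HV Hs)))).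
  cbv beta in Hp, Hq.
  eapply differentiable_pt_lim_ext with (f2 := radial_part g) in Hp.
  eapply differentiable_pt_lim_ext with (f2 := angular_part g) in Hq.
  - eexists _, _, _; split; [exact Hp|].
    (* The two computed mixed derivatives agree as polynomials; this is the closedness. *)
    match goal with |- differentiable_pt_lim _ _ _ ?A _ =>
      match type of Hq with differentiable_pt_lim _ _ _ ?B _ =>
        replace A with B
          by (generalize (g (r * cos t, r * sin t)); intros z;
              generalize (Re z) (Im z) (Re l) (Im l) (cos t) (sin t); intros; ring)
      end end.
    exact Hq.
  - exists (mkposreal _ Rlt_0_1); intros u v _ _.
    unfold angular_part, polar; destruct (g (u * cos v, u * sin v)); simpl; ring.
  - exists (mkposreal _ Rlt_0_1); intros u v _ _.
    unfold radial_part, polar; destruct (g (u * cos v, u * sin v)); simpl; ring.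
Qed.

Lemma polar_continuity_2d (g : C -> C) :
  (forall z, Ccontinuous g z) -> forall r t, continuity_2d_pt (angular_part g) r t.
Proof.
  intros Hg r t.
  assert (Hr : continuity_2d_pt (fun u _ => u) r t) by apply continuity_2d_pt_id1.
  assert (Hcos : continuity_2d_pt (fun _ v => cos v) r t).
  { eapply differentiable_pt_lim_continuous, differentiable_pt_lim_snd, is_derive_cos. }
  assert (Hsin : continuity_2d_pt (fun _ v => sin v) r t).
  { eapply differentiable_pt_lim_continuous, differentiable_pt_lim_snd, is_derive_sin. }
  assert (Hx := continuity_2d_pt_mult _ _ _ _ Hr Hcos).
  assert (Hy := continuity_2d_pt_mult _ _ _ _ Hr Hsin).
  assert (Hpol : filterlim (fun z : R * R => polar (fst z) (snd z)) (locally (r, t))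
                   (locally (T := C_UniformSpace) (polar r t))).
  { apply continuity_2d_pt_filterlim in Hx; apply continuity_2d_pt_filterlim in Hy.
    apply filterlim_locally; intros eps.
    assert (H1 := proj1 (filterlim_locally _ _) Hx eps).
    assert (H2 := proj1 (filterlim_locally _ _) Hy eps).
    generalize (filter_and _ _ H1 H2); apply filter_imp.
    intros z [h1 h2]; split; [exact h1 | exact h2]. }
  apply (continuity_2d_pt_filterlim (angular_part g)).
  assert (H := filterlim_Cmult (locally (r, t)) _ _ _ _
    (filterlim_comp _ _ _ _ _ _ _ _ Hpol (Hg (polar r t))) Hpol).
  apply filterlim_locally; intros eps.
  generalize (proj1 (filterlim_locally _ _) H eps); apply filter_imp.
  intros z [h _]; exact h.
Qed.

(** Goursat's lemma on [x, y] x [0, 2 PI] compares circles strictly between [a] and [b]; continuity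
    in the radius adds the two extreme circles. *)
Lemma angular_integral_constant (g : C -> C) (a b : R) :
  0 <= a -> a < b ->
  (forall z, Ccontinuous g z) ->
  (forall z, a < Cmod z < b -> ex_derive_C g z) ->
  RInt (angular_part g b) 0 (2 * PI) = RInt (angular_part g a) 0 (2 * PI).
Proof.
  intros Ha Hab Hc Hd.
  assert (Hpi := PI_RGT_0).
  apply (constant_of_open_interval (fun r => RInt (angular_part g r) 0 (2 * PI)) a b Hab).
  - apply continuity_pt_RInt_param; [lra|]; apply polar_continuity_2d, Hc.
  - intros x y Hxy Hyb.
    assert (H : circulation (radial_part g) (angular_part g) x y 0 (2 * PI) = 0).
    { apply circulation_eq_0; try lra.
      intros s t Hs _; apply polar_parts_differentiable, Hd.
      rewrite Cmod_polar; lra. }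
    unfold circulation in H.
    (* The rays at angles 0 and 2 PI coincide, so the radial sides cancel. *)
    rewrite (RInt_ext (fun s => radial_part g s (2 * PI)) (fun s => radial_part g s 0)) in H.
    + lra.
    + intros s _; unfold radial_part, polar.
      rewrite cos_2PI, sin_2PI, cos_0, sin_0; reflexivity.
Qed.

(** * Constancy outside the circle, from the limit at infinity *)

Global Instance C_infty_filter : Filter C_infty.
Proof.
  split.
  - exists 0; trivial.
  - intros P Q [r1 H1] [r2 H2]; exists (Rmax r1 r2); intros z Hz.
    split; [apply H1 | apply H2];
      eapply Rle_lt_trans; try exact Hz; [apply Rmax_l | apply Rmax_r].
  - intros P Q HPQ [r H]; exists r; auto.
Qed.

Lemma Re_constant_of_circle_continuous (f : C -> C) (c : C) :
  (forall z, Ccontinuous f z) ->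
  (forall z, Cmod z <> 1 -> ex_derive_C f z) ->
  filterlim f C_infty (locally (T := C_UniformSpace) c) ->
  forall w, 1 < Cmod w -> Re (f w) = Re c.
Proof.
  intros Hc Hd Hinf w Hw.
  assert (Hpi := PI_RGT_0).
  destruct (Hd w) as [l Hl]; [lra|].
  set (g := difference_quotient f w l).
  assert (Hgc : forall z, Ccontinuous g z).
  { intros z; destruct (Ceq_dec z w) as [->|Hz].
    - apply difference_quotient_continuous_base, Hl.
    - apply difference_quotient_continuous; trivial. }
  assert (Hgd : forall z, Cmod z <> 1 -> Cmod z <> Cmod w ->
     ex_derive_C g z).
  { intros z Hz1 Hzw; apply difference_quotient_ex_derive; [congruence | apply Hd, Hz1]. }
  assert (HJ : forall r, Cmod w < r -> RInt (angular_part g r) 0 (2 * PI) = 0).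
  { intros r Hr.
    (* The radius descends from r to |w|, to 1, to 0: [g] is differentiable strictly between these
       values and only continuous at the exceptional ones. *)
    rewrite (angular_integral_constant g (Cmod w) r) by (trivial; try lra; intros; apply Hgd; lra).
    rewrite (angular_integral_constant g 1 (Cmod w)) by (trivial; try lra; intros; apply Hgd; lra).
    rewrite (angular_integral_constant g 0 1) by (trivial; try lra; intros; apply Hgd; lra).
    rewrite (RInt_ext _ (fun _ => 0)).
    - rewrite RInt_const; unfold scal; simpl; unfold mult; simpl; ring.
    - intros t _; unfold angular_part, polar; simpl; ring. }
  assert (Hlim : forall eps : posreal, exists r, forall z, r < Cmod z ->
            Cmod (g z * z - (c - f w)) < 2 * eps).
  { intros eps.
    destruct (proj1 (filterlim_Cmod C_infty f c) Hinf (mkposreal _ Rlt_0_1)) as [r1 H1].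
    destruct (proj1 (filterlim_Cmod C_infty f c) Hinf eps) as [r2 H2].
    simpl in H1.
    (* [K] bounds |f z - f w| as soon as |f z - c| < 1. *)
    set (K := Cmod (c - f w) + 1).
    assert (HK : 0 < K) by (unfold K; generalize (Cmod_ge_0 (c - f w)); lra).
    (* Since z / (z - w) = 1 + w / (z - w), the remainder is at most K |w| / |z - w|; this radius
       makes it at most eps. *)
    exists (Rmax (Rmax r1 r2) (Cmod w + K * Cmod w / eps)).
    intros z Hz.
    assert (Hz3 := Rle_lt_trans _ _ _ (Rmax_r _ _) Hz).
    assert (Hz12 := Rle_lt_trans _ _ _ (Rmax_l _ _) Hz).
    specialize (H1 z (Rle_lt_trans _ _ _ (Rmax_l _ _) Hz12)).
    specialize (H2 z (Rle_lt_trans _ _ _ (Rmax_r _ _) Hz12)).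
    assert (Heps := cond_pos eps).
    assert (HKw : 0 < K * Cmod w / eps)
      by (apply Rdiv_lt_0_compat; [apply Rmult_lt_0_compat; lra | lra]).
    assert (Hzw : Cmod z - Cmod w <= Cmod (z - w)).
    { generalize (Cmod_triangle (z - w) w); replace (z - w + w)%C with z by ring; lra. }
    assert (Hzw0 : (z - w)%C <> 0%C) by (apply Cmod_gt_0; lra).
    unfold g; rewrite difference_quotient_ext by (intros ->; lra).
    replace (_ - _)%C with ((f z - c) + (f z - f w) * w / (z - w))%C by (field; exact Hzw0).
    eapply Rle_lt_trans; [apply Cmod_triangle|].
    rewrite Cmod_div, Cmod_mult by exact Hzw0.
    assert (HfK : Cmod (f z - f w) <= K).
    { replace (f z - f w)%C with ((f z - c) + (c - f w))%C by ring.
      eapply Rle_trans; [apply Cmod_triangle|]; unfold K; lra. }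
    assert (Cmod (f z - f w) * Cmod w / Cmod (z - w) <= eps); [|lra].
    apply Rmult_le_reg_r with (Cmod (z - w)); [lra|].
    unfold Rdiv; rewrite Rmult_assoc, Rinv_l, Rmult_1_r by lra.
    apply Rle_trans with (K * Cmod w); [apply Rmult_le_compat_r; lra|].
    replace (K * Cmod w) with (eps * (K * Cmod w / eps)) by (field; lra).
    apply Rmult_le_compat_l; lra. }
  apply NNPP; intros Hne.
  set (delta := Rabs (Re (c - f w)%C)).
  assert (Hdelta : 0 < delta).
  { apply Rabs_pos_lt; intros H; apply Hne.
    destruct c, (f w); simpl in *; lra. }
  (* The integral is 0 yet within 2 PI * 2 * (delta / 4) = PI delta of a constant of size 2 PI
     delta, a contradiction. *)
  assert (He : 0 < delta / 4) by lra.
  destruct (Hlim (mkposreal _ He)) as [r0 Hr0]; simpl in Hr0.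
  set (r := Rmax r0 (Cmod w) + 1).
  assert (Hr1 : r0 < r) by (unfold r; generalize (Rmax_l r0 (Cmod w)); lra).
  assert (Hr2 : Cmod w < r) by (unfold r; generalize (Rmax_r r0 (Cmod w)); lra).
  assert (Ig : ex_RInt (angular_part g r) 0 (2 * PI)).
  { apply (ex_RInt_continuous (V := R_CompleteNormedModule)).
    intros t _; apply continuity_2d_pt_snd, polar_continuity_2d, Hgc. }
  assert (Ic : ex_RInt (fun _ : R => Re (c - f w)%C) 0 (2 * PI)) by apply ex_RInt_const.
  assert (HB : Rabs (minus (RInt (angular_part g r) 0 (2 * PI))
                    (RInt (fun _ => Re (c - f w)%C) 0 (2 * PI)))
               <= (2 * PI - 0) * (2 * (delta / 4))).
  { rewrite <- (RInt_minus (V := R_CompleteNormedModule)) by assumption.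
    apply abs_RInt_le_const; [lra | apply (ex_RInt_minus (V := R_CompleteNormedModule)); assumption |].
    intros t _.
    eapply Rle_trans; [|apply Rlt_le, (Hr0 (polar r t)); rewrite Cmod_polar; lra].
    eapply Rle_trans; [|apply re_le_Cmod].
    right; f_equal. }
  rewrite HJ in HB by exact Hr2.
  rewrite RInt_const in HB.
  unfold minus, plus, opp, scal in HB; simpl in HB; unfold mult in HB; simpl in HB.
  replace (0 + - ((2 * PI - 0) * (fst c + - fst (f w))))
    with (- (2 * PI * Re (c - f w)%C)) in HB by (destruct c, (f w); simpl; ring).
  rewrite Rabs_Ropp, Rabs_mult, (Rabs_pos_eq (2 * PI)) in HB by lra.
  fold delta in HB; nra.
Qed.

(** The imaginary part of [f] is the real part of -i f, to which the previous lemma applies as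
    well. *)
Lemma constant_of_circle_continuous (f : C -> C) (c : C) :
  (forall z, Ccontinuous f z) ->
  (forall z, Cmod z <> 1 -> ex_derive_C f z) ->
  filterlim f C_infty (locally (T := C_UniformSpace) c) ->
  forall w, 1 < Cmod w -> f w = c.
Proof.
  intros Hc Hd Hinf w Hw.
  assert (HRe := Re_constant_of_circle_continuous f c Hc Hd Hinf w Hw).
  assert (HIm : Re (- Ci * f w)%C = Re (- Ci * c)%C).
  { apply (Re_constant_of_circle_continuous (fun z => - Ci * f z)%C); trivial.
    - intros z; apply filterlim_Cmult; [apply locally_filter | apply filterlim_const | apply Hc].
    - intros z Hz; apply ex_derive_Cmult; [apply ex_derive_const | apply Hd, Hz].
    - apply filterlim_Cmult; [apply C_infty_filter | apply filterlim_const | exact Hinf]. }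
  destruct (f w) as [u v], c as [u' v']; simpl in HRe, HIm; f_equal; lra.
Qed.

Lemma Cmod_locally_neq (z : C) :
  Cmod z <> 1 -> locally (T := C_UniformSpace) z (fun y => Cmod y <> 1).
Proof.
  intros Hz; apply locally_Cmod.
  assert (Hd : 0 < Rabs (Cmod z - 1)) by (apply Rabs_pos_lt; lra).
  exists (mkposreal _ Hd); simpl; intros y Hy Hy1.
  revert Hy; apply Rle_not_lt.
  assert (H1 := Cmod_triangle (y - z) z); assert (H2 := Cmod_triangle (- (y - z)) y).
  rewrite Cmod_opp in H2.
  replace (y - z + z)%C with y in H1 by ring.
  replace (- (y - z) + y)%C with z in H2 by ring.
  apply Rabs_le; lra.
Qed.

(** The values of [F] on the circle are arbitrary, so they are replaced by those of [h]. Continuity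
    of the glued function needs limits from outside, from inside and along the circle, which
    together cover a neighbourhood. *)
Lemma constant_of_circle_limits (F h : C -> C) (c : C) :
  (forall z, Cmod z <> 1 -> ex_derive_C F z) ->
  (forall L, circle L ->
     filterlim F (within exterior (locally L)) (locally (T := C_UniformSpace) (h L)) /\
     filterlim F (within Defs.interior (locally L)) (locally (T := C_UniformSpace) (h L)) /\
     filterlim h (within circle (locally L)) (locally (T := C_UniformSpace) (h L))) ->
  filterlim F C_infty (locally (T := C_UniformSpace) c) ->
  forall w, 1 < Cmod w -> F w = c.
Proof.
  intros HF Hh Hinf w Hw.
  set (f := fun z => if Req_dec_T (Cmod z) 1 then h z else F z).
  assert (HfF : forall z, Cmod z <> 1 -> f z = F z).
  { intros z Hz; unfold f; destruct Req_dec_T; tauto. }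
  assert (Hd : forall z, Cmod z <> 1 ->
             ex_derive_C f z).
  { intros z Hz.
    apply (ex_derive_ext_loc (K := C_AbsRing) (V := C_NormedModule) F); [|apply HF, Hz].
    apply locally_C; apply filter_imp with (2 := Cmod_locally_neq z Hz).
    intros y Hy; symmetry; apply HfF, Hy. }
  rewrite <- HfF by lra.
  apply constant_of_circle_continuous; trivial.
  - intros z; destruct (Req_dec_T (Cmod z) 1) as [Hz|Hz];
      [|apply ex_derive_C_continuous, Hd, Hz].
    destruct (Hh z Hz) as (He & Hi & Hc).
    unfold Ccontinuous; replace (f z) with (h z)
      by (unfold f; destruct Req_dec_T; tauto).
    intros P HP.
    specialize (He P HP); specialize (Hi P HP); specialize (Hc P HP).
    unfold filtermap, within in He, Hi, Hc.
    generalize (filter_and _ _ He (filter_and _ _ Hi Hc)).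
    unfold filtermap; apply filter_imp; intros y (H1 & H2 & H3).
    unfold f; destruct (Req_dec_T (Cmod y) 1) as [Hy|Hy].
    + apply H3, Hy.
    + destruct (Rdichotomy _ _ Hy); [apply H2 | apply H1]; assumption.
  - apply filterlim_ext_loc with (2 := Hinf).
    exists 1; intros z Hz; symmetry; apply HfF; lra.
Qed.

(** * Uniqueness for the Riemann-Hilbert problem *)

Lemma M2_ext (A B : M2) :
  (forall i j, (i < 2)%nat -> (j < 2)%nat -> entry A i j = entry B i j) -> A = B.
Proof. apply coeff_mat_ext_aux. Qed.

Lemma entry_mk_matrix (f : nat -> nat -> C) (i j : nat) :
  (i < 2)%nat -> (j < 2)%nat -> entry (mk_matrix 2 2 f) i j = f i j.
Proof. intros; apply coeff_mat_bij; assumption. Qed.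

Lemma entry_Mmul2 (A B : M2) (i j : nat) :
  (i < 2)%nat -> (j < 2)%nat ->
  entry (Mmul2 A B) i j = (entry A i 0 * entry B 0 j + entry A i 1 * entry B 1 j)%C.
Proof.
  intros Hi Hj; unfold Mmul2, Mmult; rewrite entry_mk_matrix by assumption.
  simpl; rewrite sum_Sn, sum_O; reflexivity.
Qed.

Lemma entry_Mconj2 (A : M2) (i j : nat) :
  (i < 2)%nat -> (j < 2)%nat -> entry (Mconj2 A) i j = Cconj (entry A i j).
Proof. intros Hi Hj; unfold Mconj2; rewrite entry_mk_matrix by assumption; reflexivity. Qed.

Lemma Mconj2_involutive (A : M2) : Mconj2 (Mconj2 A) = A.
Proof.
  apply M2_ext; intros i j Hi Hj; rewrite !entry_Mconj2 by assumption.
  apply Cconj_conj.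
Qed.

Lemma Mconj2_Mmul2 (A B : M2) : Mconj2 (Mmul2 A B) = Mmul2 (Mconj2 A) (Mconj2 B).
Proof.
  apply M2_ext; intros i j Hi Hj.
  rewrite entry_Mconj2, !entry_Mmul2, !entry_Mconj2 by (assumption || lia).
  rewrite Cplus_conj, !Cmult_conj; reflexivity.
Qed.

(* Right multiplication of both arguments by [V] multiplies this by [det V];
   hence it does not jump when [P] and [Q] share a jump of determinant 1. *)
Definition row_det (A B : M2) (i k : nat) : C :=
  (entry A i 0 * entry B k 1 + - (entry A i 1 * entry B k 0))%C.

Lemma row_det_Mmul2 (A B V : M2) (i k : nat) :
  (i < 2)%nat -> (k < 2)%nat ->
  row_det (Mmul2 A V) (Mmul2 B V) i k = (row_det A B i k * row_det V V 0 1)%C.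
Proof.
  intros Hi Hk; unfold row_det; rewrite !entry_Mmul2 by (assumption || lia); ring.
Qed.

Lemma filterlim_row_det (F : (C -> Prop) -> Prop) {FF : Filter F}
  (P Q : C -> M2) (A B : M2) (i k : nat) :
  (i < 2)%nat -> (k < 2)%nat -> M2_lim P F A -> M2_lim Q F B ->
  filterlim (fun z => row_det (P z) (Q z) i k) F
    (locally (T := C_UniformSpace) (row_det A B i k)).
Proof.
  intros Hi Hk HP HQ; unfold row_det.
  assert (HP0 := HP i 0%nat Hi ltac:(lia)); assert (HP1 := HP i 1%nat Hi ltac:(lia)).
  assert (HQ0 := HQ k 0%nat Hk ltac:(lia)); assert (HQ1 := HQ k 1%nat Hk ltac:(lia)).
  apply filterlim_Cplus; [exact FF | |apply filterlim_Copp; [exact FF|]];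
    apply filterlim_Cmult; assumption.
Qed.

Lemma Cexp_opp_mult (f : C) : (Cexp f * Cexp (- f))%C = 1%C.
Proof.
  unfold Cexp; destruct f as [x y]; simpl.
  rewrite exp_Ropp, cos_neg, sin_neg.
  assert (Hx := exp_pos x); assert (Hcs := sin2_cos2 y); unfold Rsqr in Hcs.
  apply injective_projections; simpl; field_simplify; try lra.
Qed.

(** [row_det A A 0 1] is the determinant of [A], and each exponential factor has determinant 1. *)
Lemma row_det_jump (X T : R) (G : M2) (L : C) :
  row_det (jump X T G L) (jump X T G L) 0 1 = row_det G G 0 1.
Proof.
  unfold jump; rewrite row_det_Mmul2 by lia.
  unfold row_det; rewrite !entry_Mmul2 by lia.
  set (f := (Ci * phase X T L)%C).
  unfold exp_sigma3, mat2; rewrite !entry_mk_matrix by lia.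
  assert (H := Cexp_opp_mult f).
  replace (- - f)%C with f by ring.
  set (e := Cexp f) in *; set (e' := Cexp (- f)) in *.
  transitivity ((e * e') * (e * e') *
     (entry G 0 0 * entry G 1 1 + - (entry G 0 1 * entry G 1 0)))%C; [ring|].
  rewrite H; ring.
Qed.

(** Before normalization the determinant is |a|^2 + |b|^2, the square of the divisor; the divisor is
    nonzero because (a, b) is not the origin. *)
Lemma row_det_Gmat (a b : C) :
  (a, b) <> (RtoC 0, RtoC 0) -> row_det (Gmat a b) (Gmat a b) 0 1 = 1%C.
Proof.
  intros Hab.
  set (s := Cmod a ^ 2 + Cmod b ^ 2).
  assert (Hs : 0 < s).
  { assert (Ha := pow2_ge_0 (Cmod a)); assert (Hb := pow2_ge_0 (Cmod b)).
    destruct (Rle_lt_dec s 0) as [H|]; [exfalso | assumption].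
    apply Hab; unfold s in H; f_equal; apply Cmod_eq_0; nra. }
  unfold row_det, Gmat, mat2; rewrite !entry_mk_matrix by lia.
  fold s; set (n := sqrt s).
  assert (Hn : n <> 0) by (apply Rgt_not_eq, sqrt_lt_R0, Hs).
  assert (Hn2 : (RtoC n * RtoC n = a * Cconj a + b * Cconj b)%C).
  { rewrite <- !Cmod2_conj, <- RtoC_mult; unfold n.
    rewrite sqrt_sqrt by lra; unfold s; rewrite RtoC_plus, !RtoC_pow; reflexivity. }
  assert (HnC : RtoC n <> 0%C) by (intros H; apply Hn, RtoC_inj, H).
  transitivity ((a * Cconj a + b * Cconj b) / (RtoC n * RtoC n))%C.
  - field; exact HnC.
  - rewrite <- Hn2; field; exact HnC.
Qed.

(** Up to sign these are the entries of P adj(Q), the usual quotient of two solutions written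
    without an inverse. They extend continuously across the circle, so they keep their value at
    infinity. *)
Lemma solves_RHP_row_det (X T : R) (G : M2) (P Q : C -> M2) (i k : nat) (w : C) :
  row_det G G 0 1 = 1%C -> (i < 2)%nat -> (k < 2)%nat ->
  solves_RHP X T G P -> solves_RHP X T G Q -> 1 < Cmod w ->
  row_det (P w) (Q w) i k = row_det Mid2 Mid2 i k.
Proof.
  intros HG Hi Hk [aP (Pp & Pm & bP & jP) iP] [aQ (Qp & Qm & bQ & jQ) iQ] Hw.
  assert (Hpm : forall L, circle L ->
            row_det (Pp L) (Qp L) i k = row_det (Pm L) (Qm L) i k).
  { intros L HL; rewrite jP, jQ by exact HL.
    rewrite row_det_Mmul2, row_det_jump, HG by assumption; ring. }
  apply (constant_of_circle_limits (fun z => row_det (P z) (Q z) i k)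
           (fun z => row_det (Pp z) (Qp z) i k)); trivial.
  - intros z Hz; unfold row_det.
    assert (H1 := ex_derive_Cmult _ _ z (aP z Hz i 0%nat Hi ltac:(lia))
                                        (aQ z Hz k 1%nat Hk ltac:(lia))).
    assert (H2 := ex_derive_Cmult _ _ z (aP z Hz i 1%nat Hi ltac:(lia))
                                        (aQ z Hz k 0%nat Hk ltac:(lia))).
    exact (ex_derive_plus (K := C_AbsRing) (V := C_NormedModule) _ _ _ H1
             (ex_derive_opp (K := C_AbsRing) (V := C_NormedModule) _ _ H2)).
  - intros L HL.
    destruct (bP L HL) as (P1 & P2 & P3 & P4).
    destruct (bQ L HL) as (Q1 & Q2 & Q3 & Q4).
    split; [|split].
    + apply filterlim_row_det; trivial; apply within_filter, locally_filter.
    + rewrite Hpm by exact HL.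
      apply filterlim_row_det; trivial; apply within_filter, locally_filter.
    + apply (filterlim_row_det (within circle (locally L)) Pp Qp); trivial.
  - apply filterlim_row_det; trivial; apply C_infty_filter.
Qed.

Lemma row_det_Mid2 (i k : nat) :
  (i < 2)%nat -> (k < 2)%nat ->
  row_det Mid2 Mid2 i k =
    match i, k with 0%nat, 1%nat => 1%C | 1%nat, 0%nat => (- (1))%C | _, _ => 0%C end.
Proof.
  intros Hi Hk; unfold row_det, Mid2, Mone; rewrite !entry_mk_matrix by lia.
  destruct i as [|[|i]], k as [|[|k]]; try lia; simpl;
    change (@one C_Ring) with (RtoC 1); change (@zero C_Ring) with (RtoC 0); ring.
Qed.

(** The first row of [P] satisfies two linear equations with the rows of [Q] as coefficients, and
    det Q = 1; Cramer's rule gives its second entry. *)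
Lemma solves_RHP_unique_entry01 (X T : R) (G : M2) (P Q : C -> M2) (w : C) :
  row_det G G 0 1 = 1%C ->
  solves_RHP X T G P -> solves_RHP X T G Q -> 1 < Cmod w ->
  entry (P w) 0 1 = entry (Q w) 0 1.
Proof.
  intros HG HP HQ Hw.
  assert (H1 := solves_RHP_row_det X T G P Q 0 0 w HG ltac:(lia) ltac:(lia) HP HQ Hw).
  assert (H2 := solves_RHP_row_det X T G P Q 0 1 w HG ltac:(lia) ltac:(lia) HP HQ Hw).
  assert (H3 := solves_RHP_row_det X T G Q Q 0 1 w HG ltac:(lia) ltac:(lia) HQ HQ Hw).
  rewrite row_det_Mid2 in H1, H2, H3 by lia.
  unfold row_det in H1, H2, H3.
  set (p0 := entry (P w) 0 0) in *; set (p1 := entry (P w) 0 1) in *.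
  set (q00 := entry (Q w) 0 0) in *; set (q01 := entry (Q w) 0 1) in *.
  set (q10 := entry (Q w) 1 0) in *; set (q11 := entry (Q w) 1 1) in *.
  transitivity (p1 * (q00 * q11 + - (q01 * q10)))%C; [rewrite H3; ring|].
  transitivity (q01 * (p0 * q11 + - (p1 * q10)) - q11 * (p0 * q01 + - (p1 * q00)))%C;
    [ring|].
  rewrite H1, H2; ring.
Qed.

(** * The symmetry *)

(** Reflection in the imaginary axis, an involutive isometry. *)
Definition reflect (z : C) : C := (- Cconj z)%C.

Lemma reflect_involutive (z : C) : reflect (reflect z) = z.
Proof. unfold reflect; rewrite Copp_conj, Cconj_conj; ring. Qed.

Lemma Cmod_reflect (z : C) : Cmod (reflect z) = Cmod z.
Proof. unfold reflect; rewrite Cmod_opp; apply Cmod_conj. Qed.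

Lemma Cmod_reflect_sub (y z : C) : Cmod (reflect y - reflect z) = Cmod (y - z).
Proof.
  rewrite <- (Cmod_reflect (y - z)); unfold reflect; rewrite Cminus_conj; f_equal; ring.
Qed.

Lemma filterlim_reflect_within (S : C -> Prop) (z : C) :
  (forall y, S y -> S (reflect y)) ->
  filterlim reflect (within S (locally z)) (within S (locally (reflect z))).
Proof.
  intros HS P HP; apply (proj1 (locally_Cmod _ _)) in HP.
  destruct HP as [d Hd]; apply locally_Cmod; exists d; intros y Hy Sy.
  apply Hd; [rewrite Cmod_reflect_sub; exact Hy | apply HS, Sy].
Qed.

Lemma filterlim_reflect_infty : filterlim reflect C_infty C_infty.
Proof.
  intros P [r Hr]; exists r; intros z Hz; apply Hr; rewrite Cmod_reflect; exact Hz.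
Qed.

Lemma filterlim_Cconj {T : Type} (F : (T -> Prop) -> Prop) {FF : Filter F}
  (f : T -> C) (l : C) :
  filterlim f F (locally (T := C_UniformSpace) l) ->
  filterlim (fun x => Cconj (f x)) F (locally (T := C_UniformSpace) (Cconj l)).
Proof.
  intros H; apply filterlim_Cmod; trivial; intros eps.
  generalize (proj1 (filterlim_Cmod F f l) H eps); apply filter_imp.
  intros x; rewrite <- Cminus_conj, Cmod_conj; trivial.
Qed.

Definition symmetric (P : C -> M2) (L : C) : M2 := Mconj2 (P (reflect L)).

Lemma M2_lim_symmetric (F F' : (C -> Prop) -> Prop) {FF : Filter F}
  (P : C -> M2) (A : M2) :
  filterlim reflect F F' -> M2_lim P F' A -> M2_lim (symmetric P) F (Mconj2 A).
Proof.
  intros Hr HP i j Hi Hj; rewrite entry_Mconj2 by assumption.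
  apply filterlim_ext with (fun z => Cconj (entry (P (reflect z)) i j)).
  - intros z; symmetry; apply entry_Mconj2; assumption.
  - apply filterlim_Cconj; trivial.
    exact (filterlim_comp _ _ _ reflect (fun z => entry (P z) i j) _ _ _ Hr (HP i j Hi Hj)).
Qed.

(** Two conjugations cancel, so the composite is again complex differentiable, with derivative
    -conj(f'(reflect z)). *)
Lemma ex_derive_symmetric (f : C -> C) (z : C) :
  ex_derive_C f (reflect z) ->
  ex_derive_C (fun y => Cconj (f (reflect y))) z.
Proof.
  intros [l Hl]; exists (reflect l); apply is_derive_C_iff; intros eps.
  destruct (proj1 (is_derive_C_iff _ _ _) Hl eps) as [d Hd].
  exists d; intros y Hy; rewrite <- Cmod_reflect_sub in Hy.
  specialize (Hd _ Hy); rewrite Cmod_reflect_sub in Hd.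
  eapply Rle_trans; [right | exact Hd].
  rewrite <- Cmod_conj; f_equal; unfold reflect.
  rewrite !Cminus_conj, !Cmult_conj, !Cconj_conj, Copp_conj, Cminus_conj, Cconj_conj; ring.
Qed.

Lemma Cexp_conj (z : C) : Cconj (Cexp z) = Cexp (Cconj z).
Proof.
  destruct z as [x y]; unfold Cexp; rewrite Cmult_conj; simpl.
  rewrite cos_neg, sin_neg; f_equal.
  unfold Cconj; simpl; apply injective_projections; simpl; ring.
Qed.

Lemma Mconj2_exp_sigma3 (f : C) : Mconj2 (exp_sigma3 f) = exp_sigma3 (Cconj f).
Proof.
  apply M2_ext; intros i j Hi Hj; rewrite entry_Mconj2 by assumption.
  unfold exp_sigma3, mat2; rewrite !entry_mk_matrix by assumption.
  destruct i as [|[|i]], j as [|[|j]]; try lia; rewrite ?Cexp_conj, ?Copp_conj;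
    try reflexivity; apply injective_projections; simpl; ring.
Qed.

Lemma Cconj_RtoC (x : R) : Cconj (RtoC x) = RtoC x.
Proof. apply injective_projections; simpl; ring. Qed.

(** Conjugating at [reflect L] amounts to substituting -L: the odd terms in X and 2/L change sign,
    the even term in T does not. *)
Lemma phase_reflect (X T : R) (L : C) :
  L <> 0%C -> Cconj (phase X T (reflect L)) = (- phase X (- T) L)%C.
Proof.
  intros HL; unfold phase.
  assert (Hr : reflect L <> 0%C).
  { intros H; apply HL; rewrite <- (reflect_involutive L), H.
    unfold reflect; apply injective_projections; simpl; ring. }
  rewrite !Cplus_conj, !Cmult_conj, Cdiv_conj, Cpow_conj, !Cconj_RtoC by exact Hr.
  unfold reflect; rewrite Copp_conj, Cconj_conj, RtoC_opp; field; exact HL.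
Qed.

(** The sign from [phase_reflect] cancels the one from conjugating i, so the exponents stay in place
    and only T is negated. *)
Lemma jump_reflect (X T : R) (G : M2) (L : C) :
  L <> 0%C -> Mconj2 (jump X T (Mconj2 G) (reflect L)) = jump X (- T) G L.
Proof.
  intros HL; unfold jump.
  assert (H : Cconj (Ci * phase X T (reflect L)) = (Ci * phase X (- T) L)%C).
  { rewrite Cmult_conj, phase_reflect by exact HL.
    replace (Cconj Ci) with (- Ci)%C by (apply injective_projections; simpl; ring).
    ring. }
  rewrite !Mconj2_Mmul2, !Mconj2_exp_sigma3, Copp_conj, H, Mconj2_involutive; reflexivity.
Qed.

(** Reflection keeps each side of the circle, so the exterior and interior boundary values retain
    their roles. *)
Lemma solves_RHP_symmetric (X T : R) (G : M2) (P : C -> M2) :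
  solves_RHP X T (Mconj2 G) P -> solves_RHP X (- T) G (symmetric P).
Proof.
  intros [aP (Pp & Pm & bP & jP) iP]; split.
  - intros z Hz i j Hi Hj.
    apply (ex_derive_ext (K := C_AbsRing) (V := C_NormedModule)
             (fun y => Cconj (entry (P (reflect y)) i j))).
    + intros y; symmetry; apply entry_Mconj2; assumption.
    + apply (ex_derive_symmetric (fun y => entry (P y) i j)), aP; trivial.
      rewrite Cmod_reflect; exact Hz.
  - exists (symmetric Pp), (symmetric Pm); split; intros L HL;
      (assert (HL' : circle (reflect L)) by (unfold circle; rewrite Cmod_reflect; exact HL)).
    + destruct (bP _ HL') as (H1 & H2 & H3 & H4).
      repeat split; (eapply M2_lim_symmetric;
        [apply within_filter, locally_filter | apply filterlim_reflect_within | eassumption]);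
        unfold exterior, Defs.interior, circle; intros y; rewrite Cmod_reflect; trivial.
    + unfold symmetric; rewrite jP, Mconj2_Mmul2, jump_reflect by
        (trivial; intros ->; unfold circle in HL; rewrite Cmod_0 in HL; lra).
      reflexivity.
  - replace Mid2 with (Mconj2 Mid2).
    + eapply M2_lim_symmetric; [apply C_infty_filter | apply filterlim_reflect_infty | exact iP].
    + apply M2_ext; intros i j Hi Hj; rewrite entry_Mconj2 by assumption.
      unfold Mid2, Mone; rewrite entry_mk_matrix by assumption.
      destruct i as [|[|i]], j as [|[|j]]; try lia; apply Cconj_RtoC.
Qed.

(** * The symmetry carried through the choices of solution and limit *)

Lemma choose_or_spec {A : Type} (d : A) (Q : A -> Prop) :
  (exists x, Q x) -> Q (choose_or d Q).
Proof.
  intros H; unfold choose_or; destruct excluded_middle_informative as [h|h]; [|tauto].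
  apply proj2_sig.
Qed.

Lemma choose_or_default {A : Type} (d : A) (Q : A -> Prop) :
  ~ (exists x, Q x) -> choose_or d Q = d.
Proof.
  intros H; unfold choose_or; destruct excluded_middle_informative; tauto.
Qed.

Global Instance C_infty_proper_filter : ProperFilter C_infty.
Proof.
  split; [|apply C_infty_filter].
  intros P [r Hr]; exists (RtoC (Rabs r + 1)); apply Hr.
  rewrite Cmod_R, Rabs_pos_eq; generalize (Rle_abs r) (Rabs_pos r); lra.
Qed.

Lemma lim_infty_unique (f : C -> C) (l : C) :
  filterlim f C_infty (locally (T := C_UniformSpace) l) -> lim_infty f = l.
Proof.
  intros H; unfold lim_infty.
  apply (filterlim_locally_unique (V := C_NormedModule) (F := C_infty) f); [|exact H].
  apply (choose_or_spec (RtoC 0)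
    (fun l => filterlim f C_infty (locally (T := C_UniformSpace) l))); exists l; exact H.
Qed.

Lemma filterlim_reflect_comp (f g : C -> C) (l : C) :
  C_infty (fun z => g z = reflect (f (reflect z))) ->
  filterlim f C_infty (locally (T := C_UniformSpace) l) ->
  filterlim g C_infty (locally (T := C_UniformSpace) (reflect l)).
Proof.
  intros Hfg Hf; apply filterlim_ext_loc with (fun z => reflect (f (reflect z))).
  - revert Hfg; apply filter_imp; auto.
  - unfold reflect at 1 3; apply filterlim_Copp; [apply C_infty_filter|].
    apply filterlim_Cconj; [apply C_infty_filter|].
    exact (filterlim_comp _ _ _ reflect f _ _ _ filterlim_reflect_infty Hf).
Qed.

(** As [reflect] is an involution, [f] has a limit exactly when [g] has one. Without limits both
    sides are the default 0, which [reflect] fixes. *)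
Lemma lim_infty_reflect (f g : C -> C) :
  C_infty (fun z => g z = reflect (f (reflect z))) ->
  lim_infty g = reflect (lim_infty f).
Proof.
  intros Hfg.
  destruct (classic (exists l, filterlim f C_infty (locally (T := C_UniformSpace) l)))
    as [[l Hl]|Hno].
  - rewrite (lim_infty_unique f l Hl).
    apply lim_infty_unique; revert Hl; apply filterlim_reflect_comp, Hfg.
  - unfold lim_infty; rewrite !choose_or_default.
    + apply injective_projections; simpl; ring.
    + exact Hno.
    + intros [l Hl]; apply Hno; exists (reflect l); revert Hl.
      apply filterlim_reflect_comp.
      destruct Hfg as [r Hr]; exists r; intros z Hz.
      rewrite Hr by (rewrite Cmod_reflect; exact Hz).
      rewrite !reflect_involutive; reflexivity.
Qed.

Lemma RHP_solution_symmetric (a b : C) (X T : R) (L : C) :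
  (a, b) <> (RtoC 0, RtoC 0) -> 1 < Cmod L ->
  entry (RHP_solution X (- T) (Gmat a b) L) 0 1 =
  Cconj (entry (RHP_solution X T (Mconj2 (Gmat a b)) (reflect L)) 0 1).
Proof.
  intros Hab HL; unfold RHP_solution.
  set (G := Gmat a b).
  destruct (classic (exists P, solves_RHP X T (Mconj2 G) P)) as [He|Hno].
  (* The solution chosen for (X, -T, G) may differ from the reflected one; uniqueness outside the
     circle identifies their entries. *)
  - assert (H2 := solves_RHP_symmetric _ _ _ _ (choose_or_spec (fun _ => Mid2) _ He)).
    assert (H1 := choose_or_spec (fun _ => Mid2) _ (ex_intro _ _ H2)).
    rewrite (solves_RHP_unique_entry01 _ _ _ _ _ L (row_det_Gmat a b Hab) H1 H2 HL).
    apply entry_Mconj2; lia.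
  - rewrite !choose_or_default.
    (* Without a solution both choices return the identity, whose entries are real. *)
    + unfold Mid2, Mone; rewrite entry_mk_matrix by lia; symmetry; apply Cconj_RtoC.
    + exact Hno.
    (* The symmetry is its own inverse: negating T and conjugating G twice restores the data. *)
    + intros [P HP]; apply Hno; exists (symmetric P).
      rewrite <- (Ropp_involutive T); apply solves_RHP_symmetric.
      rewrite Mconj2_involutive; exact HP.
Qed.

Theorem proposition1p4 :
  forall (a b : C) (X T : R),
    (a, b) <> (RtoC 0, RtoC 0) ->
    Psi X (- T)%R (Gmat a b) = Cconj (Psi X T (Mconj2 (Gmat a b))).
Proof.
  intros a b X T Hab; unfold Psi.
  rewrite (lim_infty_reflect
    (fun L => L * entry (RHP_solution X T (Mconj2 (Gmat a b)) L) 0 1)%C).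
  (* Conjugating 2i produces the minus sign contained in [reflect]. *)
  - set (l := lim_infty _); unfold reflect.
    rewrite !Cmult_conj, Cconj_RtoC.
    replace (Cconj Ci) with (- Ci)%C by (apply injective_projections; simpl; ring).
    ring.
  (* With p the entry at [reflect L], L conj(p) = reflect(reflect L * p): the factor L turns
     conjugation into [reflect]. *)
  - exists 1; intros L HL; rewrite RHP_solution_symmetric by assumption.
    set (e := entry _ 0 1); unfold reflect.
    rewrite Cmult_conj, Copp_conj, Cconj_conj; ring.
Qed.
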